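(* Let $\mathbb{K}$ be a field of characteristic zero. Let $r\geq 2$ be an integer and let $\sigma(z)=a_1z+a_2z^2+\cdots+a_rz^r\in\mathbb{K}[z]$ be a polynomial with zero constant term such that $a_r\neq 0$ and $a_{r-1}\neq 0$. Then, for every pair of nonzero distinct polynomials $p,q\in\mathbb{K}[t]$ with $p(0)=q(0)=0$, the polynomials $\sigma(p)$ and $\sigma(q)$ are non-proportional over $\mathbb{K}$.
   Context: $\sigma(p)$ denotes the composition $\sigma(p(t))\in\mathbb{K}[t]$. Two polynomials are non-proportional if they are linearly independent over $\mathbb{K}$. *)

(* Defs.v *)
From HB Require Import structures.
From mathcomp Require Import all_boot all_order all_algebra.

Set Implicit Arguments.
Unset Strict Implicit.
Unset Printing Implicit Defensive.

Import GRing.Theory.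
Local Open Scope ring_scope.

(* Linear independence of the pair (f, g). The library's [free] requires a
   finite-dimensional [vectType], which {poly K} is not. *)
Definition non_proportional (K : fieldType) (f g : {poly K}) : Prop :=
  forall c d : K, c *: f + d *: g = 0 -> c = 0 /\ d = 0.

(* Main.v *)
Require Import Defs.
From HB Require Import structures.
From mathcomp Require Import all_boot all_order all_algebra.

Set Implicit Arguments.
Unset Strict Implicit.
Unset Printing Implicit Defensive.

Import GRing.Theory.
Local Open Scope ring_scope.

(** A polynomial that vanishes at 0 is determined, up to a scalar, by the top
    terms of its image under sigma.  Suppose that sigma(p) = l sigma(q) with l
    nonzero.  Then p and q have the same degree n > 0, and comparing leading
    coefficients gives l = m^r, where m is the ratio of the leading
    coefficients of p and q.  Put u = m q, so that p and u have the same
    leading term.  The terms of degree r of sigma give p^r - u^r, and all the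
    others have degree at most n (r - 1); hence deg (p^r - u^r) <= n (r - 1).
    But p^r - u^r is p - u times a sum of r products, each with leading
    coefficient lc(p)^(r-1) in degree n (r - 1); in characteristic zero these
    leading terms add up instead of cancelling, so p - u must be constant
    ([size_sub_le1]), and it vanishes at 0: p = m q
    ([eq_scale_of_comp_proportional]).

    Since q is transcendental over K, sigma(m q) = l sigma(q) is an identity
    between coefficients of sigma: m^i = l whenever sigma has a nonzero
    coefficient of index i ([comp_scale_coef]).  Taking i = r and i = r - 1
    gives m = 1, that is p = q.

    A dependence c sigma(p) + d sigma(q) = 0 that is not trivial has c and d
    both nonzero, as sigma(p) and sigma(q) are nonzero, so l = - d / c is
    nonzero as required. *)

Lemma size_expS (R : idomainType) (f : {poly R}) (n k : nat) :
  size f = n.+1 -> size (f ^+ k) = (n * k).+1.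
Proof.
move=> size_f; have f_neq0 : f != 0 by rewrite -size_poly_eq0 size_f.
have size_gt0 : (0 < size (f ^+ k)%R)%N by rewrite size_poly_gt0 expf_neq0.
by rewrite -(prednK size_gt0) size_exp size_f.
Qed.

(** In characteristic zero the r leading coefficients, all equal to
    lc(p)^(r-1), have a nonzero sum. *)
Lemma size_sum_geom_gt (K : fieldType) (p u : {poly K}) (n r : nat) :
    [pchar K] =i pred0 -> (0 < r)%N ->
    size p = n.+1 -> size u = n.+1 -> lead_coef p = lead_coef u ->
  (n * r.-1 < size (\sum_(i < r) p ^+ (r.-1 - i) * u ^+ i)%R)%N.
Proof.
move=> charK0 r_gt0 sp su lpu; rewrite ltnNge; apply/negP => le_size.
have p_neq0 : p != 0 by rewrite -size_poly_eq0 sp.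
have u_neq0 : u != 0 by rewrite -size_poly_eq0 su.
have /eqP := nth_default 0 le_size; rewrite coef_sum.
rewrite (eq_bigr (fun=> lead_coef p ^+ r.-1)) => [|i _].
  rewrite sumr_const card_ord -mulr_natr mulf_eq0 expf_eq0 lead_coef_eq0.
  by rewrite (negPf p_neq0) andbF /= ((pcharf0P K).1 charK0) eqn0Ngt r_gt0.
have le_i : (i <= r.-1)%N by rewrite -ltnS prednK.
set t := _ * _.
have t_neq0 : t != 0 by rewrite mulf_neq0 ?expf_neq0.
have size_t : (size t).-1 = (n * r.-1)%N.
  by rewrite size_mul ?expf_neq0 // !(size_expS _ sp, size_expS _ su) addnS /=
             -mulnDr subnK.
rewrite -size_t -/(lead_coef t) lead_coefM !lead_coef_exp -lpu.
by rewrite -exprD subnK.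
Qed.

(** A nonconstant p - u would make the degree of
    p^r - u^r = (p - u) (p^(r-1) + ... + u^(r-1)) exceed n (r - 1). *)
Lemma size_sub_le1 (K : fieldType) (p u : {poly K}) (n r : nat) :
    [pchar K] =i pred0 -> (0 < r)%N ->
    size p = n.+1 -> size u = n.+1 -> lead_coef p = lead_coef u ->
    (size (p ^+ r - u ^+ r)%R <= (n * r.-1).+1)%N ->
  (size (p - u)%R <= 1)%N.
Proof.
move=> charK0 r_gt0 sp su lpu; rewrite subrXX.
have lt_size := size_sum_geom_gt charK0 r_gt0 sp su lpu.
have [->|pu_neq0] := eqVneq (p - u) 0; first by rewrite size_poly0.
rewrite size_mul //; last by rewrite -size_poly_gt0 (leq_ltn_trans _ lt_size).
rewrite leqNgt => le_size; rewrite leqNgt; apply: contra le_size => gt1.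
by rewrite -(subnKC gt1) /= !addSn /= ltnS (leq_trans lt_size) // leq_addl.
Qed.

Lemma coef_comp_scaleX (R : comNzRingType) (s : {poly R}) (m : R) (i : nat) :
  (s \Po (m *: 'X))`_i = s`_i * m ^+ i.
Proof.
rewrite coef_comp_poly.
under eq_bigr => j _ do rewrite exprZn coefZ coefXn.
have [lt_i|le_i] := ltnP i (size s); last first.
  rewrite (nth_default 0 le_i) mul0r big1 // => j _.
  by rewrite gtn_eqF ?(leq_trans (ltn_ord j)) // !mulr0.
rewrite (bigD1 (Ordinal lt_i)) //= eqxx mulr1 big1 ?addr0 // => j.
by rewrite -val_eqE eq_sym /= => /negPf ->; rewrite !mulr0.
Qed.

(** Composition with a nonconstant q is injective, so coefficients of s
    can be compared. *)
Lemma comp_scale_coef (R : idomainType) (s q : {poly R}) (m l : R) (i : nat) :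
    (1 < size q)%N -> s \Po (m *: q) = l *: (s \Po q) ->
    s`_i != 0 ->
  m ^+ i = l.
Proof.
move=> q_gt1 eq_s si_neq0.
have : (s \Po (m *: 'X) - l *: s) \Po q == 0.
  by rewrite comp_polyB comp_polyZ -comp_polyA comp_polyZ comp_polyX eq_s subrr.
rewrite comp_poly_eq0 // => /eqP/(congr1 (fun f : {poly R} => f`_i))/eqP.
rewrite coefB coefZ coef_comp_scaleX coef0 mulrC -mulrBl mulf_eq0.
by rewrite (negPf si_neq0) orbF subr_eq0 => /eqP.
Qed.

Lemma size_gt1_root0 (R : nzRingType) (p : {poly R}) :
  p != 0 -> p.[0] = 0 -> (1 < size p)%N.
Proof.
move=> p_neq0 p0; rewrite ltnNge; apply: contra p_neq0 => /size1_polyC eq_p.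
by rewrite eq_p -horner_coef0 p0.
Qed.

(** The scalar m is the ratio of the leading coefficients.  It makes the
    terms of top degree of s(p) and l s(q) equal l_s p^r and l_s (m q)^r, with
    l_s the leading coefficient of s; what remains has degree at most
    n (r - 1), so [size_sub_le1] shows that p - m q is a constant, and its
    value at 0 is 0. *)
Lemma eq_scale_of_comp_proportional (K : fieldType) (s p q : {poly K}) (l : K) :
    [pchar K] =i pred0 -> (1 < size s)%N ->
    p != 0 -> q != 0 -> p.[0] = 0 -> q.[0] = 0 -> l != 0 ->
    s \Po p = l *: (s \Po q) ->
  exists m, p = m *: q.
Proof.
move=> charK0 s_gt1 p_neq0 q_neq0 p0 q0 l_neq0 eq_s.
have p_gt1 := size_gt1_root0 p_neq0 p0; have q_gt1 := size_gt1_root0 q_neq0 q0.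
pose r := (size s).-1; have r_gt0 : (0 < r)%N by rewrite -ltnS prednK // ltnW.
have size_s : size s = r.+1 by rewrite prednK // ltnW.
have ls_neq0 : lead_coef s != 0.
  by rewrite lead_coef_eq0 -size_poly_eq0 size_s.
have lq_neq0 : lead_coef q != 0 by rewrite lead_coef_eq0.
pose n := (size q).-1; have size_q : size q = n.+1 by rewrite prednK // ltnW.
have size_p : size p = n.+1.
  have /eqP := congr1 (fun f : {poly K} => (size f).-1) eq_s.
  rewrite size_scale // !size_comp_poly size_s /= eqn_pmul2l //.
  by rewrite size_q /= => /eqP <-; rewrite prednK // ltnW.
pose m := lead_coef p / lead_coef q; exists m.
have m_neq0 : m != 0 by rewrite mulf_neq0 ?invr_neq0 ?lead_coef_eq0.
have lead_u : lead_coef p = lead_coef (m *: q) by rewrite lead_coefZ divfK.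
have mr : m ^+ r = l.
  have := congr1 lead_coef eq_s.
  rewrite lead_coefZ !lead_coef_comp // -/r mulrCA => /(mulfI ls_neq0) eq_lead.
  by rewrite expr_div_n eq_lead mulfK // expf_neq0.
(* The part of s of degree below r. *)
pose t := s - lead_coef s *: 'X^r.
have size_t : (size t <= r)%N.
  apply/leq_sizeP => i le_ri; rewrite coefB coefZ coefXn.
  have [->|ne_ir] := eqVneq i r; first by rewrite mulr1 subrr.
  by rewrite mulr0 subr0 nth_default // size_s ltn_neqAle eq_sym ne_ir.
have size_tc (f : {poly K}) : size f = n.+1 ->
    (size (t \Po f) <= (n * r.-1).+1)%N.
  move=> size_f; apply: leq_trans (size_comp_poly_leq _ _) _.
  rewrite ltnS size_f mulnC leq_mul2l; apply/orP; right.
  by rewrite -!subn1 leq_sub2r.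
have s_comp (f : {poly K}) : s \Po f = t \Po f + lead_coef s *: f ^+ r.
  by rewrite comp_polyB comp_polyZ comp_Xn_poly subrK.
have size_pow : (size (p ^+ r - (m *: q) ^+ r)%R <= (n * r.-1).+1)%N.
  have -> : p ^+ r - (m *: q) ^+ r
      = (lead_coef s)^-1 *: (l *: (t \Po q) - (t \Po p)).
    apply: (canRL (scalerK ls_neq0)).
    rewrite scalerBr exprZn mr scalerA [_ * l]mulrC -scalerA.
    apply/eqP; rewrite subr_eq addrAC eq_sym subr_eq -scalerDr -s_comp -eq_s.
    by rewrite s_comp addrC.
  rewrite (leq_trans (size_scale_leq _ _)) //.
  rewrite (leq_trans (size_polyD _ _)) // geq_max size_polyN.
  by rewrite (leq_trans (size_scale_leq _ _)) ?size_tc.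
have size_u : size (m *: q) = n.+1 by rewrite size_scale.
have le1 := size_sub_le1 charK0 r_gt0 size_p size_u lead_u size_pow.
apply/eqP; rewrite -subr_eq0; apply: contraLR le1 => pu_neq0.
by rewrite -ltnNge size_gt1_root0 // hornerD hornerN hornerZ p0 q0 mulr0 subr0.
Qed.

Theorem proposition3p3 (K : fieldType) (charK0 : [pchar K] =i pred0)
    (r : nat) (hr : (2 <= r)%N) (a : nat -> K) (sigma : {poly K})
    (hsigma : sigma = \sum_(1 <= i < r.+1) a i *: 'X^i)
    (har : a r != 0) (har1 : a r.-1 != 0)
    (p q : {poly K}) (hp : p != 0) (hq : q != 0) (hpq : p != q)
    (hp0 : p.[0] = 0) (hq0 : q.[0] = 0) :
  non_proportional (sigma \Po p) (sigma \Po q).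
Proof.
have coef_sigma i : (0 < i <= r)%N -> sigma`_i = a i.
  move=> hi; rewrite hsigma coef_sumMXn.
  by rewrite big_nat1_eq ltnS hi.
have r_gt0 : (0 < r)%N by exact: ltnW.
have sr_neq0 : sigma`_r != 0 by rewrite coef_sigma // r_gt0 leqnn.
have sr1_neq0 : sigma`_r.-1 != 0.
  by rewrite coef_sigma // leq_pred andbT -ltnS prednK.
have sigma_gt1 : (1 < size sigma)%N.
  by rewrite ltnNge; apply: contra sr_neq0 => /leq_sizeP ->.
have sigma_neq0 : sigma != 0 by rewrite -size_poly_gt0 ltnW.
have p_gt1 := size_gt1_root0 hp hp0; have q_gt1 := size_gt1_root0 hq hq0.
move=> c d eq0.
have [c0|c_neq0] := eqVneq c 0.
  split=> //; move/eqP: eq0; rewrite c0 scale0r add0r scaler_eq0.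
  by rewrite comp_poly_eq0 // (negPf sigma_neq0) orbF => /eqP.
have [d0|d_neq0] := eqVneq d 0.
  move/eqP: eq0; rewrite d0 scale0r addr0 scaler_eq0.
  by rewrite comp_poly_eq0 // (negPf sigma_neq0) (negPf c_neq0).
pose l := - (c^-1 * d).
have l_neq0 : l != 0 by rewrite oppr_eq0 mulf_neq0 ?invr_neq0.
have eq_s : sigma \Po p = l *: (sigma \Po q).
  move/eqP: eq0; rewrite addr_eq0 => /eqP/(congr1 ( *:%R c^-1)).
  by rewrite scalerK // scalerN scalerA scaleNr.
have [m def_p] :=
  eq_scale_of_comp_proportional charK0 sigma_gt1 hp hq hp0 hq0 l_neq0 eq_s.
rewrite def_p in eq_s.
have mr := comp_scale_coef q_gt1 eq_s sr_neq0.
have mr1 := comp_scale_coef q_gt1 eq_s sr1_neq0.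
case/eqP: hpq; rewrite def_p.
suff -> : m = 1 by rewrite scale1r.
by apply: (mulIf l_neq0); rewrite mul1r -[in LHS]mr1 -exprS prednK.
Qed.
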